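(* Let $\{a_n\}_{n=0}^\infty$ be any one of the following sequences: the Motzkin numbers $M_n$, the Fine numbers $F_n$, the Franel numbers $F_n^{(3)}$ of order $3$, the Franel numbers $F_n^{(4)}$ of order $4$, or the large Schröder numbers $s_n$. Then $\{a_n\}$ is strictly 2-log-convex except possibly for a fixed number of terms at the beginning; that is, there is a positive integer $N$ such that for all $n\ge N$, $$a_n^2\le a_{n-1}a_{n+1}\quad\text{and}\quad\left(a_na_{n+2}-a_{n+1}^2\right)^2<\left(a_{n-1}a_{n+1}-a_n^2\right)\left(a_{n+1}a_{n+3}-a_{n+2}^2\right).$$
   Context: Let $C_k=\frac{1}{k+1}\binom{2k}{k}$ be the Catalan numbers. The Motzkin numbers are $M_n=\sum_{k\ge 0}\binom{n}{2k}C_k$. The Fine numbers are defined by $F_0=1$ and $C_n=2F_n+F_{n-1}$ for $n\ge 1$ (so they begin $1,0,1,2,6,18,57,\dots$). The Franel numbers of order $r$ are $F_n^{(r)}=\sum_{k=0}^n\binom{n}{k}^r$. The large Schröder numbers are $s_n=\sum_{k=0}^n\binom{n+k}{2k}C_k$ (beginning $1,2,6,22,\dots$). *)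

(* Defs.v *)
From mathcomp Require Import all_boot all_order all_algebra.

Set Implicit Arguments.
Unset Strict Implicit.
Unset Printing Implicit Defensive.

Import Order.TTheory GRing.Theory Num.Theory.
Local Open Scope ring_scope.

(* The sequences are integer-valued; they are taken in rat so that the        *)
(* divisions in catalan and fine are genuine ones.                            *)

Definition catalan (k : nat) : rat := 'C(2 * k, k)%:R / k.+1%:R.

(* The terms with k > n vanish, since then n < 2 * k. *)
Definition motzkin (n : nat) : rat :=
  \sum_(k < n.+1) 'C(n, 2 * k)%:R * catalan k.

(* The recurrence C_n = 2 F_n + F_(n-1) solved for F_n; see fine_rec. *)
Fixpoint fine (n : nat) : rat :=
  if n is m.+1 then (catalan m.+1 - fine m) / 2%:R else 1.

Lemma fine_rec (n : nat) :
  (0 < n)%N -> catalan n = 2%:R * fine n + fine n.-1.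
Proof. by case: n => // n _ /=; rewrite mulrC divfK // subrK. Qed.

Definition franel (r n : nat) : rat := \sum_(k < n.+1) 'C(n, k)%:R ^+ r.

Definition schroeder (n : nat) : rat :=
  \sum_(k < n.+1) 'C(n + k, 2 * k)%:R * catalan k.

(* Main.v *)
Require Import Defs.
From mathcomp Require Import all_boot all_order all_algebra.
From mathcomp Require Import archimedean realalg ring lra zify.

Set Implicit Arguments.
Unset Strict Implicit.
Unset Printing Implicit Defensive.

Import Order.TTheory GRing.Theory Num.Theory.
Local Open Scope ring_scope.

(** Write [r n = a n.+1 / a n] and [D n = r n.+1 - r n].  Both inequalities are
    statements about [r]: since [a n * a n.+2 - a n.+1 ^+ 2] equals
    [a n * a n.+1 * D n], they hold as soon as [D] is positive and satisfies
    [D n.+1 ^+ 2 <= D n * D n.+2]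
    ([ratio_differences_two_log_convex]).  So it is enough to know [D] well.

    All five sequences satisfy a recurrence
    [gamma n * a n.+2 = alpha n * a n.+1 + beta n * a n] with polynomial
    coefficients.  The Fine numbers inherit theirs from the Catalan numbers; the
    other four are sums of hypergeometric terms, and creative telescoping
    ([creative_telescoping]) reduces each recurrence to a polynomial identity.

    Dividing by [a n.+1] turns the recurrence into
    [r n.+1 = alpha / gamma + (beta / gamma) / r n].  In the range where [r]
    lives this map is a contraction, so an approximate solution is close to the
    true one: if [P] is a quartic polynomial such that [P n / n ^ 4] solves the
    recurrence up to an error [O(n ^ -5)], then [n ^ 4 * r n - P n] tends to 0
    ([contraction_vanishes], [ratio_expansion_of_recurrence]).  Such a [P] is
    found by comparing coefficients; checking it is a matter of polynomial
    inequalities (the [ratio_model] lemmas).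

    If [P] is [c0 x^4 + c1 x^3 + ...] with [c1 < 0], it follows that
    [n ^ 4 * D n = - c1 * n ^ 2 + b * n + c + o(1)] for some constants [b] and
    [c] ([vanishes_differences]).  The sequence [1 / n ^ 2] is log-convex, the
    second difference of its logarithm being about [2 / n ^ 2], and the
    correction terms change that second difference by [o(n ^ -2)] only; so [D]
    is eventually log-convex ([quadratic_over_quartic_log_convex]).

    The ratio of consecutive Schroeder numbers tends to [3 + 2 sqrt 2].  For
    these the argument takes place in the field of real algebraic numbers, and
    the resulting inequalities are then read back in the rationals. *)

(** * Recurrences by creative telescoping *)

Lemma sum_ord_extend (F : nat -> rat) (m d : nat) :
  (forall k, (m <= k)%N -> F k = 0) ->
  \sum_(k < m + d) F k = \sum_(k < m) F k.
Proof.
move=> F0; elim: d => [|d IHd]; first by rewrite addn0.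
by rewrite addnS big_ord_recr /= IHd F0 ?addr0 // leq_addr.
Qed.

(** Zeilberger's method: the left-hand side of the summand identity is a
    difference in [k], so its sum over [k < n.+3] collapses.  The three sums have
    different ranges, but [t0] and [t1] vanish beyond theirs. *)
Lemma creative_telescoping (n : nat) (p0 p1 p2 : rat) (t0 t1 t2 G : nat -> rat) :
  (forall k, (n < k)%N -> t0 k = 0) -> (forall k, (n.+1 < k)%N -> t1 k = 0) ->
  (forall k, p2 * t2 k - p1 * t1 k - p0 * t0 k = G k.+1 - G k) ->
  G 0%N = 0 -> G n.+3 = 0 ->
  p2 * \sum_(k < n.+3) t2 k =
    p1 * \sum_(k < n.+2) t1 k + p0 * \sum_(k < n.+1) t0 k.
Proof.
move=> t0z t1z step G0 Gn; apply/eqP; rewrite -subr_eq0 opprD addrA.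
rewrite -(sum_ord_extend 1 t1z) -(sum_ord_extend 2 t0z) addn1 addn2.
rewrite !mulr_sumr -!sumrB (eq_bigr (fun k : 'I_n.+3 => G k.+1 - G k)) //.
by rewrite -(big_mkord xpredT (fun k => G k.+1 - G k)) telescope_sumr // Gn G0 subrr.
Qed.

(** Taking the difference in [rat] rather than in [nat] makes this hold for all
    [k]: beyond the support either a binomial or the factor is zero. *)
Lemma bin_upr (n k : nat) :
  n.+1%:R * 'C(n, k)%:R = (n.+1%:R - k%:R) * 'C(n.+1, k)%:R :> rat.
Proof.
have [le_kn|lt_nk] := leqP k n.+1; last by rewrite !bin_small ?mulr0 // ltnW.
by rewrite -natrB // -!natrM -mul_bin_down.
Qed.

Lemma bin_rightr (n k : nat) :
  k.+1%:R * 'C(n, k.+1)%:R = (n%:R - k%:R) * 'C(n, k)%:R :> rat.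
Proof.
have [le_kn|lt_nk] := leqP k n; last by rewrite !bin_small ?mulr0 // ltnW.
by rewrite -natrB // -!natrM mul_bin_left.
Qed.

Lemma catalanS (k : nat) :
  k.+2%:R * catalan k.+1 = 2%:R * (2%:R * k%:R + 1) * catalan k.
Proof.
have nz j : j.+1%:R != 0 :> rat by rewrite pnatr_eq0.
rewrite /catalan mulrCA divff // mulr1 mulrA; apply: (canRL (mulfK _)) => //.
have := mul_bin_diag (2 * k).+2 k; have := mul_bin_down (2 * k).+1 k.
rewrite mulnS /= mul2n -addnn -addSn addnK addSn addnn -mul2n => h1 h2.
rewrite [LHS]mulrC add2n -[LHS]natrM -h2 natrM.
have -> : (2 * k)%N.+2%:R = 2%:R * k.+1%:R :> rat by rewrite -natrM mulnS.
by rewrite -!mulrA -[k.+1%:R * _]natrM -h1 natrM -[(2 * k)%N.+1%:R]natr1 natrM.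
Qed.

Lemma fine_recurrence (n : nat) :
  (2%:R * n%:R + 6%:R) * fine n.+2 =
    (7%:R * n%:R + 9%:R) * fine n.+1 + (4%:R * n%:R + 6%:R) * fine n.
Proof.
have := catalanS n.+1; rewrite (fine_rec (ltn0Sn n.+1)) (fine_rec (ltn0Sn n)).
rewrite -[n.+3]addn3 -addn1 !natrD /= => h; lra.
Qed.

(** The factor [c k] is [n! / (k! (n + 2 - k)!)], extended by zero.  It turns
    the three rows occurring in a recurrence of order two into polynomial
    multiples of one term, with no denominator left to vanish at the ends of
    the range. *)
Lemma binomial_common_factor (n : nat) :
  exists c : nat -> rat, forall k : nat,
  [/\ 'C(n, k)%:R = c k * ((n%:R + 2 - k%:R) * (n%:R + 1 - k%:R)),
      'C(n.+1, k)%:R = c k * ((n%:R + 1) * (n%:R + 2 - k%:R)),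
      'C(n.+2, k)%:R = c k * ((n%:R + 1) * (n%:R + 2)) &
      c k.+1 * k.+1%:R = c k * (n%:R + 2 - k%:R)].
Proof.
have nz1 : n%:R + 1 != 0 :> rat by rewrite natr1 pnatr_eq0.
have nz2 : n%:R + 2%:R != 0 :> rat by rewrite -natrD addn2 pnatr_eq0.
have S1 : n.+1%:R = n%:R + 1 :> rat by rewrite natr1.
have S2 : n.+2%:R = n%:R + 2%:R :> rat by rewrite -natrD addn2.
exists (fun k => 'C(n.+2, k)%:R / ((n%:R + 1) * (n%:R + 2%:R))) => k.
have h1 := bin_upr n.+1 k; have h0 := bin_upr n k; have hk := bin_rightr n.+2 k.
rewrite S1 in h0; rewrite S2 in h1 hk.
have e1 : 'C(n.+1, k)%:R =
    (n%:R + 2%:R - k%:R) * 'C(n.+2, k)%:R / (n%:R + 2%:R) :> rat.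
  by rewrite -h1 mulrC mulKf.
have e0 : 'C(n, k)%:R = (n%:R + 1 - k%:R) * 'C(n.+1, k)%:R / (n%:R + 1) :> rat.
  by rewrite -h0 mulrC mulKf.
split; first by rewrite e0 e1; field; apply/andP.
- by rewrite e1; field; apply/andP.
- by field; apply/andP.
- by rewrite mulrAC [_ * k.+1%:R]mulrC hk; field; apply/andP.
Qed.

Lemma franel3_recurrence (n : nat) :
  (n%:R + 2) ^+ 2 * franel 3 n.+2 =
    (7 * n%:R ^+ 2 + 21 * n%:R + 16) * franel 3 n.+1
    + 8 * (n%:R + 1) ^+ 2 * franel 3 n.
Proof.
have [c hc] := binomial_common_factor n.
(* The certificate: [P] is a polynomial in [n] and [k], found by linear algebra,
   such that [P (k + 1) * (n + 2 - k) ^ 3 - P k * k ^ 3] equals the combination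
   of the three cubes in the recurrence, divided by [c k ^ 3]. *)
pose P (k : rat) : rat := let n := n%:R in
  - (14*n^+5 + 102*n^+4 + 290*n^+3 + 402*n^+2 + 272*n + 72)
  + (27*n^+4 + 147*n^+3 + 291*n^+2 + 249*n + 78) * k
  - (18*n^+3 + 66*n^+2 + 78*n + 30) * k ^+ 2
  + (4*n^+2 + 8*n + 4) * k ^+ 3.
pose G k : rat := P k%:R * (c k * k%:R) ^+ 3.
have GS k : G k.+1 = P (k%:R + 1) * (c k * (n%:R + 2 - k%:R)) ^+ 3.
  by have [_ _ _ e] := hc k; rewrite /G e natr1.
rewrite /franel; apply: (@creative_telescoping _ _ _ _
  (fun k => 'C(n, k)%:R ^+ 3)
  (fun k => 'C(n.+1, k)%:R ^+ 3) (fun k => 'C(n.+2, k)%:R ^+ 3) G).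
- by move=> k lt_nk; rewrite bin_small // expr0n.
- by move=> k lt_nk; rewrite bin_small // expr0n.
- move=> k; rewrite GS /G; have [-> -> -> _] := hc k; rewrite /P.
  by move: (c k) (n%:R) (k%:R) => C N K; ring.
- by rewrite /G mulr0 expr0n mulr0.
- by rewrite GS -natrD addn2 subrr mulr0 expr0n mulr0.
Qed.

Lemma franel4_recurrence (n : nat) :
  (n%:R + 2) ^+ 3 * franel 4 n.+2 =
    (4 * n%:R + 6) * (3 * n%:R ^+ 2 + 9 * n%:R + 7) * franel 4 n.+1
    + 4 * (n%:R + 1) * (4 * n%:R + 3) * (4 * n%:R + 5) * franel 4 n.
Proof.
have [c hc] := binomial_common_factor n.
(* The certificate: [P] is a polynomial in [n] and [k], found by linear algebra,
   such that [P (k + 1) * (n + 2 - k) ^ 4 - P k * k ^ 4] equals the combination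
   of the three fourth powers in the recurrence, divided by [c k ^ 4]. *)
pose P (k : rat) : rat := let n := n%:R in
  - (75*n^+7 + 800*n^+6 + 3610*n^+5 + 8930*n^+4 + 13075*n^+3 + 11330*n^+2
     + 5380*n + 1080)
  + (260*n^+6 + 2316*n^+5 + 8476*n^+4 + 16312*n^+3 + 17412*n^+2 + 9776*n
     + 2256) * k
  - (374*n^+5 + 2688*n^+4 + 7612*n^+3 + 10620*n^+2 + 7302*n + 1980) * k ^+ 2
  + (276*n^+4 + 1520*n^+3 + 3088*n^+2 + 2744*n + 900) * k ^+ 3
  - (104*n^+3 + 402*n^+2 + 508*n + 210) * k ^+ 4
  + (16*n^+2 + 36*n + 20) * k ^+ 5.
pose G k : rat := P k%:R * (c k * k%:R) ^+ 4.
have GS k : G k.+1 = P (k%:R + 1) * (c k * (n%:R + 2 - k%:R)) ^+ 4.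
  by have [_ _ _ e] := hc k; rewrite /G e natr1.
rewrite /franel; apply: (@creative_telescoping _ _ _ _
  (fun k => 'C(n, k)%:R ^+ 4)
  (fun k => 'C(n.+1, k)%:R ^+ 4) (fun k => 'C(n.+2, k)%:R ^+ 4) G).
- by move=> k lt_nk; rewrite bin_small // expr0n.
- by move=> k lt_nk; rewrite bin_small // expr0n.
- move=> k; rewrite GS /G; have [-> -> -> _] := hc k; rewrite /P.
  by move: (c k) (n%:R) (k%:R) => C N K; ring.
- by rewrite /G mulr0 expr0n mulr0.
- by rewrite GS -natrD addn2 subrr mulr0 expr0n mulr0.
Qed.

(** The common factor is [n! / ((n + 2 - 2 k)! k! (k + 1)!)]. *)
Lemma motzkin_recurrence (n : nat) :
  (n%:R + 4) * motzkin n.+2 =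
    (2 * n%:R + 5) * motzkin n.+1 + 3 * (n%:R + 1) * motzkin n.
Proof.
have nz j : j.+1%:R != 0 :> rat by rewrite pnatr_eq0.
have nz1 : n%:R + 1 != 0 :> rat by rewrite natr1.
have nz2 : n%:R + 2%:R != 0 :> rat by rewrite -natrD addn2.
pose c k := 'C(n.+2, 2 * k)%:R * catalan k / ((n%:R + 1) * (n%:R + 2)).
have [c' hc] := binomial_common_factor n.
have cE k : c k = c' (2 * k)%N * catalan k.
  by have [_ _ e _] := hc (2 * k)%N; rewrite /c e; field; apply/andP.
have cS k : c k.+1 * ((k%:R + 1) * (k%:R + 2)) =
    c k * ((n%:R + 2 - 2 * k%:R) * (n%:R + 1 - 2 * k%:R)).
  have [_ _ _ e0] := hc (2 * k)%N; have [_ _ _ e1] := hc (2 * k).+1.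
  have ec := catalanS k.
  have e2 : (2 * k)%N.+2%:R = 2 * (k%:R + 1) :> rat.
    by rewrite -natr1 -natr1 natrM; ring.
  rewrite -[(2 * k)%N.+1%:R]natr1 natrM in e0 e1; rewrite e2 in e1.
  rewrite -[k.+2%:R]natr1 -natr1 in ec.
  rewrite !cE mulnS add2n.
  have nzk : 2 * (2 * k%:R + 1) != 0 :> rat.
    by rewrite mulf_neq0 // -natrM natr1 pnatr_eq0.
  apply: (mulfI nzk).
  transitivity ((2 * k%:R + 1) * (c' (2 * k)%N.+2 * (2 * (k%:R + 1))) *
    ((k%:R + 1 + 1) * catalan k.+1)); first by ring.
  rewrite e1 ec.
  transitivity (c' (2 * k)%N.+1 * (2 * k%:R + 1) * (n%:R + 2 - (2 * k%:R + 1)) *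
    (2 * (2 * k%:R + 1) * catalan k)); first by ring.
  by rewrite e0; ring.
(* Here the polynomial part of the certificate does not involve [k]. *)
pose G k : rat := - (4 * n%:R + 4) * c k * (k%:R * (k%:R + 1)).
have GS k : G k.+1 = - (4 * n%:R + 4) *
    (c k * ((n%:R + 2 - 2 * k%:R) * (n%:R + 1 - 2 * k%:R))).
  by rewrite -cS /G -natr1; ring.
have c0 k : (n.+2 < 2 * k)%N -> c k = 0.
  by move=> h; rewrite /c bin_small // !mul0r.
rewrite /motzkin; apply: (@creative_telescoping _ _ _ _
  (fun k => 'C(n, 2 * k)%:R * catalan k)
  (fun k => 'C(n.+1, 2 * k)%:R * catalan k)
  (fun k => 'C(n.+2, 2 * k)%:R * catalan k) G).
- by move=> k lt_nk; rewrite bin_small ?mul0r //; lia.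
- by move=> k lt_nk; rewrite bin_small ?mul0r //; lia.
- move=> k; rewrite GS /G cE; have [-> -> -> _] := hc (2 * k)%N; rewrite natrM.
  by move: (c' _) (catalan k) (n%:R) (k%:R) => C D N K; ring.
- by rewrite /G mul0r mulr0.
- by rewrite /G c0 ?mulr0 ?mul0r //; lia.
Qed.

(** The common factor is [(n + k)! / ((n + 2 - k)! k! (k + 1)!)]. *)
Lemma schroeder_recurrence (n : nat) :
  (n%:R + 3) * schroeder n.+2 =
    (6 * n%:R + 9) * schroeder n.+1 - n%:R * schroeder n.
Proof.
have nz j : j.+1%:R != 0 :> rat by rewrite pnatr_eq0.
have nz1 k : n%:R + 1 + k%:R != 0 :> rat by rewrite natr1 -natrD addSn.
have nz2 k : n%:R + 2%:R + k%:R != 0 :> rat by rewrite -!natrD addn2 addSn.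
pose c k := 'C(n.+2 + k, 2 * k)%:R * catalan k /
  ((n%:R + 1 + k%:R) * (n%:R + 2 + k%:R)).
have t2E k : 'C(n.+2 + k, 2 * k)%:R * catalan k =
    c k * ((n%:R + 1 + k%:R) * (n%:R + 2 + k%:R)).
  by rewrite /c divfK // mulf_neq0.
have t1E k : 'C(n.+1 + k, 2 * k)%:R * catalan k =
    c k * ((n%:R + 1 + k%:R) * (n%:R + 2 - k%:R)).
  have e := bin_upr (n.+1 + k) (2 * k); rewrite -addSn in e.
  have e2 : (n.+2 + k)%N%:R = n%:R + 2 + k%:R :> rat by rewrite -addn2 !natrD.
  rewrite natrM e2 in e.
  apply: (mulfI (nz2 k)); rewrite mulrA e.
  transitivity ((n%:R + 2 - k%:R) * ('C(n.+2 + k, 2 * k)%:R * catalan k)).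
    by ring.
  by rewrite t2E; ring.
have t0E k : 'C(n + k, 2 * k)%:R * catalan k =
    c k * ((n%:R + 1 - k%:R) * (n%:R + 2 - k%:R)).
  have e := bin_upr (n + k) (2 * k); rewrite -addSn in e.
  have e2 : (n.+1 + k)%N%:R = n%:R + 1 + k%:R :> rat by rewrite -addn1 !natrD.
  rewrite natrM e2 in e.
  apply: (mulfI (nz1 k)); rewrite mulrA e.
  transitivity ((n%:R + 1 - k%:R) * ('C(n.+1 + k, 2 * k)%:R * catalan k)).
    by ring.
  by rewrite t1E; ring.
have cS k : c k.+1 * ((k%:R + 1) * (k%:R + 2)) =
    c k * ((n%:R + 1 + k%:R) * (n%:R + 2 - k%:R)).
  rewrite -t1E.
  have ec := catalanS k; rewrite -[k.+2%:R]natr1 -natr1 in ec.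
  have eb : (2 * k%:R + 1) * (2 * (k%:R + 1)) * 'C(n.+3 + k, (2 * k).+2)%:R =
      (n%:R + 2 + k%:R) * (n%:R + 3 + k%:R) * 'C(n.+1 + k, 2 * k)%:R :> rat.
    have h2 : (n%:R + 3 + k%:R) * 'C(n.+2 + k, (2 * k).+1)%:R =
        2 * (k%:R + 1) * 'C(n.+3 + k, (2 * k).+2)%:R :> rat.
      have -> : n%:R + 3 + k%:R = (n.+3 + k)%N%:R :> rat by rewrite -!natrD addn3.
      have -> : 2 * (k%:R + 1) = (2 * k)%N.+2%:R :> rat.
        by rewrite -[(2 * k)%N.+2%:R]natr1 -[(2 * k)%N.+1%:R]natr1 natrM; ring.
      by rewrite -!natrM (mul_bin_diag (n.+3 + k) (2 * k).+1).
    have h1 : (n%:R + 2 + k%:R) * 'C(n.+1 + k, 2 * k)%:R =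
        (2 * k%:R + 1) * 'C(n.+2 + k, (2 * k).+1)%:R :> rat.
      have -> : n%:R + 2 + k%:R = (n.+2 + k)%N%:R :> rat by rewrite -!natrD addn2.
      have -> : 2 * k%:R + 1 = (2 * k)%N.+1%:R :> rat by rewrite -[RHS]natr1 natrM.
      by rewrite -!natrM (mul_bin_diag (n.+2 + k) (2 * k)).
    by rewrite -mulrA -h2 mulrCA -h1; ring.
  have nz3 : n%:R + 3%:R + k%:R != 0 :> rat by rewrite -!natrD addn3 !addSn.
  rewrite /c mulnS add2n addnS -addSn -[k.+1%:R]natr1.
  transitivity ((2 * k%:R + 1) * (2 * (k%:R + 1)) * 'C(n.+3 + k, (2 * k).+2)%:R *
    catalan k / ((n%:R + 2 + k%:R) * (n%:R + 3 + k%:R))).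
    transitivity ('C(n.+3 + k, (2 * k).+2)%:R * (k%:R + 1) * ((k%:R + 1 + 1) *
      catalan k.+1) / ((n%:R + 2 + k%:R) * (n%:R + 3 + k%:R))).
      by field; do ?[apply/andP; split].
    by rewrite ec; field; do ?[apply/andP; split].
  by rewrite eb; field; do ?[apply/andP; split].
pose G k : rat := - (4 * n%:R + 6) * c k * (k%:R * (k%:R + 1)).
have GS k : G k.+1 = - (4 * n%:R + 6) *
    (c k * ((n%:R + 1 + k%:R) * (n%:R + 2 - k%:R))).
  by rewrite -cS /G -natr1; ring.
have c0 k : (n.+2 < k)%N -> c k = 0.
  by move=> h; rewrite /c bin_small ?mul0r //; lia.
rewrite /schroeder -mulNr; apply: (@creative_telescoping _ _ _ _
  (fun k => 'C(n + k, 2 * k)%:R * catalan k)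
  (fun k => 'C(n.+1 + k, 2 * k)%:R * catalan k)
  (fun k => 'C(n.+2 + k, 2 * k)%:R * catalan k) G).
- by move=> k lt_nk; rewrite bin_small ?mul0r //; lia.
- by move=> k lt_nk; rewrite bin_small ?mul0r //; lia.
- move=> k; rewrite GS /G t0E t1E t2E.
  by move: (c k) (n%:R) (k%:R) => C N K; ring.
- by rewrite /G mul0r mulr0.
- by rewrite /G c0 ?mulr0 ?mul0r.
Qed.

(** * Null sequences and contractions *)

Definition vanishes (R : archiRealFieldType) (f : nat -> R) : Prop :=
  forall eps, 0 < eps -> exists N, forall n, (N <= n)%N -> `|f n| <= eps.

Lemma natr_eventually_ge (R : archiRealFieldType) (x : R) :
  exists N, forall n, (N <= n)%N -> x <= n%:R.
Proof.
exists (Num.bound `|x|) => n le_n; apply: (@le_trans _ _ (Num.bound `|x|)%:R).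
  by rewrite (le_trans (ler_norm x)) // ltW // archi_boundP.
by rewrite ler_nat.
Qed.

Lemma vanishes_divn (R : archiRealFieldType) (C : R) :
  vanishes (fun n => C / n%:R).
Proof.
move=> eps eps0; have [N geN] := natr_eventually_ge (`|C| / eps).
exists N.+1 => n lt_n; have n0 : 0 < n%:R :> R by rewrite ltr0n; lia.
rewrite normrM normfV (gtr0_norm n0) ler_pdivrMr // -ler_pdivrMl // mulrC.
by apply: geN; lia.
Qed.

(** Once [delta] is below [(1 - kappa) * eps / 2], the excess of [d] over
    [eps / 2] shrinks by the factor [kappa] at each step, hence geometrically. *)
Lemma contraction_vanishes (R : archiRealFieldType) (d delta : nat -> R)
    (kappa : R) (N : nat) :
  0 <= kappa < 1 -> (forall n, 0 <= d n) -> vanishes delta ->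
  (forall n, (N <= n)%N -> d n.+1 <= kappa * d n + delta n) -> vanishes d.
Proof.
move=> /andP[k0 k1] d0 delta0 step eps eps0.
have h0 : 0 < 1 - kappa by lra.
have eta0 : 0 < (1 - kappa) * (eps / 2) by rewrite mulr_gt0 // divr_gt0.
have [N1 deltaN1] := delta0 _ eta0.
set M := maxn N N1.
(* Bernoulli in the form [kappa ^ m * (1 + m * (1 - kappa)) <= 1] replaces powers
   of [kappa]. *)
have bound m : (d (M + m)%N - eps / 2) * (1 + m%:R * (1 - kappa)) <= d M.
  elim: m => [|m IHm]; first by rewrite addn0 mul0r addr0 mulr1; lra.
  set g := d (M + m)%N - eps / 2 in IHm.
  have m0 : 0 <= m%:R :> R by [].
  have gS : d (M + m.+1)%N - eps / 2 <= kappa * g.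
    have leN : (N <= M + m)%N by rewrite (leq_trans (leq_maxl N N1)) ?leq_addr.
    have leN1 : (N1 <= M + m)%N by rewrite (leq_trans (leq_maxr N N1)) ?leq_addr.
    rewrite addnS; have := step _ leN; have /ler_normlP[_] := deltaN1 _ leN1.
    by rewrite /g; clear; lra.
  rewrite -[m.+1%:R]natr1; set w := 1 + (m%:R + 1) * (1 - kappa).
  have w0 : 0 <= w by rewrite /w; nra.
  apply: (le_trans (ler_wpM2r w0 gS)).
  have [g0|g0] := leP 0 g; last first.
    by rewrite (le_trans _ (d0 M)) // mulr_le0_ge0 // mulr_ge0_le0 // ltW.
  apply: le_trans IHm; rewrite mulrAC mulrC ler_wpM2l // /w.
  by have := mulr_ge0 m0 (sqr_ge0 (1 - kappa)); have := sqr_ge0 (1 - kappa); lra.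
have [m0 gem0] := natr_eventually_ge (d M / ((1 - kappa) * (eps / 2))).
exists (M + m0)%N => n le_n; rewrite ger0_norm //.
have -> : n = (M + (n - M))%N by lia.
have := gem0 (n - M)%N ltac:(lia); rewrite ler_pdivrMr // => hm.
have := bound (n - M)%N; set m := (n - M)%N in hm *.
rewrite leNgt => hb; apply/negP => gt_eps; move/negP: hb; apply.
apply: (le_lt_trans hm).
have m1 : 0 <= m%:R :> R by [].
by have := mulr_ge0 m1 (ltW h0); nra.
Qed.

(** * From differences of ratios to 2-log-convexity *)

Definition eventually_strictly_two_log_convex (R : numDomainType) (a : nat -> R) :=
  exists2 N : nat, (0 < N)%N &
    forall n : nat, (N <= n)%N ->
      a n ^+ 2 <= a n.-1 * a n.+1 /\
      (a n * a n.+2 - a n.+1 ^+ 2) ^+ 2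
        < (a n.-1 * a n.+1 - a n ^+ 2) * (a n.+1 * a n.+3 - a n.+2 ^+ 2).

(** The three determinants are [a0 * a1 * D1], [a1 * a2 * D2] and
    [a2 * a3 * D3]; strictness comes from [a1 * a2 < a0 * a3], that is, from the
    ratios being increasing. *)
Lemma ratio_differences_two_log_convex (R : realFieldType) (a0 a1 a2 a3 a4 : R) :
  0 < a0 -> 0 < a1 -> 0 < a2 -> 0 < a3 ->
  let D1 := a2 / a1 - a1 / a0 in let D2 := a3 / a2 - a2 / a1 in
  let D3 := a4 / a3 - a3 / a2 in
  0 < D1 -> 0 < D2 -> 0 < D3 -> D2 ^+ 2 <= D1 * D3 ->
  a1 ^+ 2 <= a0 * a2 /\
  (a1 * a3 - a2 ^+ 2) ^+ 2 < (a0 * a2 - a1 ^+ 2) * (a2 * a4 - a3 ^+ 2).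
Proof.
move=> p0 p1 p2 p3 D1 D2 D3 d1 d2 d3 dd.
have nz x : 0 < x -> x != 0 :> R by move=> ?; rewrite gt_eqF.
have e1 : a0 * a2 - a1 ^+ 2 = a0 * a1 * D1 by rewrite /D1; field; rewrite !nz.
have e2 : a1 * a3 - a2 ^+ 2 = a1 * a2 * D2 by rewrite /D2; field; rewrite !nz.
have e3 : a2 * a4 - a3 ^+ 2 = a2 * a3 * D3 by rewrite /D3; field; rewrite !nz.
have lt_r : a1 * a2 < a0 * a3.
  rewrite -subr_gt0; have -> : a0 * a3 - a1 * a2 = a0 * a2 * (D1 + D2).
    by rewrite /D1 /D2; field; rewrite !nz.
  by rewrite !mulr_gt0 // addr_gt0.
split; first by rewrite -subr_ge0 e1 !mulr_ge0 // ltW.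
rewrite e1 e2 e3 exprMn.
apply: (@le_lt_trans _ _ ((a1 * a2) ^+ 2 * (D1 * D3))).
  by rewrite ler_wpM2l // sqr_ge0.
rewrite -subr_gt0.
have -> : a0 * a1 * D1 * (a2 * a3 * D3) - (a1 * a2) ^+ 2 * (D1 * D3) =
  a1 * a2 * (D1 * D3) * (a0 * a3 - a1 * a2) by ring.
by rewrite !mulr_gt0 // subr_gt0.
Qed.

(** Read [A], [B], [C] as values of [y ^ 4 * D] at [y = x - 1, x, x + 1]; the
    conclusion says that [D x ^ 2 <= D (x - 1) * D (x + 1)].  With
    [X = x ^ 2], [q x] close to [X] and up to a common factor [X ^ 2], the
    difference of the two sides is about [(2 - 4 + 4) * X ^ 3].  Here [2 * X ^ 3]
    and [- 4 * X ^ 3] come from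
    [q (x - 1) * q (x + 1) = (q x + 1) ^ 2 - (2 * x + f) ^ 2], and [4 * X ^ 3]
    from [(x - 1) ^ 4 * (x + 1) ^ 4 = (X - 1) ^ 4].  The errors [1 / 8] and the
    terms [f * x], [g], small compared with [X], use up only a part of it. *)
Lemma perturbed_quadratic_over_quartic (R : realFieldType) (x f g A B C : R) :
  100%:R <= x -> 20%:R * `|f| <= x -> 40%:R * `|g| <= x ->
  let q y : R := y ^+ 2 + f * y + g in
  q (x - 1) - 8%:R^-1 <= A -> 0 <= B <= q x + 8%:R^-1 -> q (x + 1) - 8%:R^-1 <= C ->
  [/\ 0 < A, 0 < C &
      B ^+ 2 * ((x - 1) ^+ 4 * (x + 1) ^+ 4) <= A * C * (x ^+ 4) ^+ 2].
Proof.
move=> x100 fx gx q hA /andP[B0 hB] hC.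
have {}fx : - x <= 20%:R * f <= x by rewrite -ler_norml normrM gtr0_norm.
have {}gx : - x <= 40%:R * g <= x by rewrite -ler_norml normrM gtr0_norm.
case/andP: fx => f1 f2; case/andP: gx => g1 g2.
set X := x ^+ 2; set Q := q x - 8%:R^-1.
have X1 : 100%:R * x <= X by rewrite /X; nra.
have fX1 : - X <= 20%:R * (f * x) by rewrite /X; nra.
have fX2 : 20%:R * (f * x) <= X by rewrite /X; nra.
have Q1 : 9%:R * X <= 10%:R * Q by rewrite /Q /q -/X; lra.
have Q2 : 10%:R * (Q + 4%:R^-1) <= 11%:R * X by rewrite /Q /q -/X; lra.
set u := 2 * x + f.
have eA : q (x - 1) - 8%:R^-1 = Q + 1 - u by rewrite /Q /q /u; ring.
have eC : q (x + 1) - 8%:R^-1 = Q + 1 + u by rewrite /Q /q /u; ring.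
rewrite eA in hA; rewrite eC in hC.
have u0 : 0 <= u by rewrite /u; lra.
have uQ : u < Q by rewrite /u; lra.
have hu : 100%:R * u ^+ 2 <= 441%:R * X.
  have u2 : 20%:R * u <= 42%:R * x by rewrite /u; lra.
  have : (20%:R * u) ^+ 2 <= (42%:R * x) ^+ 2 by rewrite lerXn2r ?nnegrE //; lra.
  rewrite /X; lra.
have hAC : (Q + 1) ^+ 2 - u ^+ 2 <= A * C.
  have -> : (Q + 1) ^+ 2 - u ^+ 2 = (Q + 1 - u) * (Q + 1 + u) by ring.
  by apply: ler_pM => //; lra.
have hB2 : B ^+ 2 <= (Q + 4%:R^-1) ^+ 2.
  by rewrite lerXn2r ?nnegrE //; rewrite /Q; lra.
split; [lra | lra |].
have e4 : (x - 1) ^+ 4 * (x + 1) ^+ 4 = (X - 1) ^+ 4 by rewrite /X; ring.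
have -> : (x ^+ 4) ^+ 2 = X ^+ 4 by rewrite /X; ring.
rewrite e4.
have X0 : 1000%:R <= X by lra.
have X41 : 0 <= (X - 1) ^+ 4 by rewrite exprn_even_ge0.
have X42 : 0 <= X ^+ 4 by rewrite exprn_even_ge0.
apply: (le_trans (ler_wpM2r X41 hB2)); apply: (le_trans _ (ler_wpM2r X42 hAC)).
have hX : (X - 1) ^+ 4 <= X ^+ 2 * (X ^+ 2 - 4%:R * X + 6%:R).
  rewrite -subr_ge0.
  have -> : X ^+ 2 * (X ^+ 2 - 4%:R * X + 6%:R) - (X - 1) ^+ 4 = 4%:R * X - 1.
    by ring.
  lra.
apply: (le_trans (ler_wpM2l (sqr_ge0 _) hX)).
have -> : X ^+ 4 = X ^+ 2 * X ^+ 2 by ring.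
rewrite mulrCA [_ * (X ^+ 2 * X ^+ 2)]mulrCA ler_wpM2l ?sqr_ge0 //.
have W1 : (9%:R * X) ^+ 2 <= (10%:R * (Q + 4%:R^-1)) ^+ 2.
  by rewrite lerXn2r ?nnegrE //; move: X0 Q1; clear; lra.
have W2 : 0 <= 4%:R * X - 6%:R by move: X0; clear; lra.
have W3 := ler_wpM2l W2 W1.
have W4 := ler_wpM2r (sqr_ge0 X) hu.
have W5 := ler_wpM2r (sqr_ge0 X) Q1.
have W6 : 1000%:R * X ^+ 2 <= X * X ^+ 2 by rewrite ler_wpM2r ?sqr_ge0.
have W7 := sqr_ge0 X; move: W3 W4 W5 W6 => /=; lra.
Qed.

(** Dividing by [lam] makes the quadratic monic, so that
    [perturbed_quadratic_over_quartic] applies at [x = n.+1]. *)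
Lemma quadratic_over_quartic_log_convex (R : archiRealFieldType) (D : nat -> R)
    (lam b c : R) :
  0 < lam ->
  vanishes (fun n => n%:R ^+ 4 * D n - (lam * n%:R ^+ 2 + b * n%:R + c)) ->
  exists N, forall n, (N <= n)%N ->
    [/\ 0 < D n & D n.+1 ^+ 2 <= D n * D n.+2].
Proof.
move=> lam0 Dasym; have lamN0 : lam != 0 by rewrite gt_eqF.
have lam80 : 0 < lam / 8%:R by rewrite divr_gt0.
have [N0 hD] := Dasym _ lam80.
have [N1 ge100] := natr_eventually_ge (100%:R : R).
have [N2 gef] := natr_eventually_ge (20%:R * `|b / lam|).
have [N3 geg] := natr_eventually_ge (40%:R * `|c / lam|).
exists (N0 + N1 + N2 + N3).+1 => n le_n.
set x : R := n.+1%:R.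
have nE : n%:R = x - 1 by rewrite /x -natr1 addrK.
have nE2 : n.+2%:R = x + 1 by rewrite /x natr1.
have x100 : 100%:R <= x by apply: ge100; lia.
pose q y : R := y ^+ 2 + b / lam * y + c / lam.
have hn m : (n <= m)%N ->
    q m%:R - 8%:R^-1 <= m%:R ^+ 4 * (D m / lam) <= q m%:R + 8%:R^-1.
  move=> le_m; have := hD m ltac:(lia).
  have -> : lam * m%:R ^+ 2 + b * m%:R + c = lam * q m%:R.
    by rewrite /q; field.
  have -> : m%:R ^+ 4 * D m = lam * (m%:R ^+ 4 * (D m / lam)).
    by field.
  rewrite -mulrBr normrM gtr0_norm // ler_pM2l // ler_norml; lra.
have /andP[hA _] := hn n (leqnn n).
have /andP[_ hB] := hn n.+1 (leqnSn n).
have /andP[hC _] := hn n.+2 ltac:(lia).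
have /andP[hB' _] := hn n.+1 (leqnSn n).
rewrite nE in hA; rewrite nE2 in hC; rewrite -/x in hB hB'.
have gex : 20%:R * `|b / lam| <= x by apply: gef; move: le_n; clear; lia.
have gex' : 40%:R * `|c / lam| <= x by apply: geg; move: le_n; clear; lia.
have B0 : 0 <= x ^+ 4 * (D n.+1 / lam).
  move: gex gex'; rewrite -{1}(gtr0_norm (_ : 0 < 20%:R :> R)) //.
  rewrite -{1}(gtr0_norm (_ : 0 < 40%:R :> R)) // -!normrM !ler_norml.
  move=> /andP[h1 h2] /andP[h3 h4]; apply: le_trans hB'.
  have : 100%:R * x <= x ^+ 2 by rewrite expr2 ler_wpM2r //; lra.
  have : - x * x <= 20%:R * (b / lam) * x by rewrite ler_wpM2r //; lra.
  by rewrite /q; lra.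
have B1 := introT andP (conj B0 hB).
have [A0 C0 hABC] := perturbed_quadratic_over_quartic x100 gex gex' hA B1 hC.
have [xm4 xp4 x4] : [/\ 0 < (x - 1) ^+ 4, 0 < (x + 1) ^+ 4 & 0 < x ^+ 4].
  by split; rewrite exprn_gt0; move: x100; clear; lra.
split; first by move: A0; rewrite pmulr_rgt0 // pmulr_lgt0 ?invr_gt0.
have w0 : 0 < (x - 1) ^+ 4 * (x + 1) ^+ 4 * (x ^+ 4) ^+ 2 / lam ^+ 2.
  apply: divr_gt0; rewrite ?exprn_gt0 //.
  by apply: mulr_gt0; rewrite ?exprn_gt0 //; apply: mulr_gt0.
rewrite -(ler_pM2r w0).
have -> : D n.+1 ^+ 2 * ((x - 1) ^+ 4 * (x + 1) ^+ 4 * (x ^+ 4) ^+ 2 / lam ^+ 2) =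
  (x ^+ 4 * (D n.+1 / lam)) ^+ 2 * ((x - 1) ^+ 4 * (x + 1) ^+ 4).
  by field.
apply: (le_trans hABC); rewrite le_eqVlt; apply/orP; left; apply/eqP.
by field.
Qed.

Definition quartic (R : pzRingType) (c0 c1 c2 c3 c4 x : R) : R :=
  c0 * x ^+ 4 + c1 * x ^+ 3 + c2 * x ^+ 2 + c3 * x + c4.

(** With [v = n / (n + 1)] one has [1 - v = v / n], so every difference
    [1 / n ^ i - 1 / (n + 1) ^ i] is [1 / n ^ i] times a polynomial in [v]
    divided by [n].  Expanding [n ^ 4 * (r n.+1 - r n)] leaves a remainder
    [H / n] in which [H] is a polynomial in [v], bounded as [0 <= v <= 1]. *)
Lemma vanishes_differences (R : archiRealFieldType) (r : nat -> R)
    (c0 c1 c2 c3 c4 : R) :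
  vanishes (fun n => n%:R ^+ 4 * r n - quartic c0 c1 c2 c3 c4 n%:R) ->
  vanishes (fun n => n%:R ^+ 4 * (r n.+1 - r n) -
    (- c1 * n%:R ^+ 2 + (c1 - 2 * c2) * n%:R + (3 * c2 - 3 * c3 - c1))).
Proof.
move=> rasym eps eps0.
set K := `|c1| + 4%:R * `|c2| + 6%:R * `|c3| + 4%:R * `|c4|.
have [N0 h0] := rasym (eps / 4%:R) ltac:(lra).
have [N1 h1] := vanishes_divn K (ltac:(lra) : 0 < eps / 4%:R).
exists (N0 + N1).+1 => n le_n.
have x0 : 0 < n%:R :> R by rewrite ltr0n; lia.
have {}h1 := h1 n ltac:(lia); have hn := h0 n ltac:(lia).
have hn1 := h0 n.+1 ltac:(lia); rewrite -natr1 in hn1.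
move: x0 hn hn1 h1; set x := n%:R => x0 hn hn1 h1.
set v := x / (x + 1).
have v01 : 0 <= v <= 1.
  by rewrite /v divr_ge0 ?ler_pdivrMr /=; lra.
have x10 : x + 1 != 0 by rewrite gt_eqF //; lra.
set H := c1 * v - c2 * (3 * v + v ^+ 2) +
  c3 * (3 * v + 2 * v ^+ 2 + v ^+ 3) - c4 * (v + v ^+ 2 + v ^+ 3 + v ^+ 4).
have -> : x ^+ 4 * (r n.+1 - r n) -
    (- c1 * x ^+ 2 + (c1 - 2 * c2) * x + (3 * c2 - 3 * c3 - c1)) =
  v ^+ 4 * ((x + 1) ^+ 4 * r n.+1 - quartic c0 c1 c2 c3 c4 (x + 1)) -
  (x ^+ 4 * r n - quartic c0 c1 c2 c3 c4 x) + H / x.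
  by rewrite /H /v /quartic; field; rewrite x10 gt_eqF.
have [v0 v1] : 0 <= v /\ v <= 1 by apply/andP.
have v2 : 0 <= v ^+ 2 <= 1 by rewrite exprn_ge0 // exprn_ile1.
have v3 : 0 <= v ^+ 3 <= 1 by rewrite exprn_ge0 // exprn_ile1.
have v4 : 0 <= v ^+ 4 <= 1 by rewrite exprn_ge0 // exprn_ile1.
have scale (c w m : R) : 0 <= w <= m -> `|c * w| <= `|c| * m.
  by case/andP=> w0 wm; rewrite normrM (ger0_norm w0) ler_wpM2l.
have HK : `|H| <= K.
  rewrite /H /K; apply: (le_trans (ler_normB _ _)); apply: lerD; last first.
    by rewrite [leRHS]mulrC scale //; lra.
  apply: (le_trans (ler_normD _ _)); apply: lerD; last first.
    by rewrite [leRHS]mulrC scale //; lra.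
  apply: (le_trans (ler_normB _ _)); apply: lerD; last first.
    by rewrite [leRHS]mulrC scale //; lra.
  by rewrite -[leRHS]mulr1 scale.
have hv : `|v ^+ 4 * ((x + 1) ^+ 4 * r n.+1 - quartic c0 c1 c2 c3 c4 (x + 1))|
    <= eps / 4%:R.
  rewrite normrM -[leRHS]mul1r; case/andP: v4 => v40 v41.
  by apply: ler_pM => //; rewrite ger0_norm.
have hH : `|H / x| <= eps / 4%:R.
  apply: le_trans (le_trans (ler_norm _) h1).
  by rewrite normrM normfV (gtr0_norm x0) ler_pM2r ?invr_gt0.
apply: (le_trans (ler_normD _ _)); apply: (le_trans (lerD (ler_normB _ _) hH)).
lra.
Qed.

Lemma two_log_convex_of_ratio_expansion (R : archiRealFieldType)
    (a : nat -> R) (c0 c1 c2 c3 c4 : R) (n0 : nat) :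
  (forall n, (n0 <= n)%N -> 0 < a n) -> c1 < 0 ->
  vanishes (fun n => n%:R ^+ 4 * (a n.+1 / a n) - quartic c0 c1 c2 c3 c4 n%:R) ->
  eventually_strictly_two_log_convex a.
Proof.
move=> a0 c10 /vanishes_differences asym.
have lam0 : 0 < - c1 by rewrite oppr_gt0.
have [N hN] := quadratic_over_quartic_log_convex lam0 asym.
exists (n0 + N).+1 => // -[//|n] le_n /=.
have [d0 dd] := hN n ltac:(lia).
have [d1 _] := hN n.+1 ltac:(lia); have [d2 _] := hN n.+2 ltac:(lia).
by apply: ratio_differences_two_log_convex => //; apply: a0; lia.
Qed.

(** * Expansions of ratios from recurrences *)

(** Conditions under which [P x / x ^ 4] approximates the ratios of a solution of
    [gamma * a'' = alpha * a' + beta * a] with ratios at least [low].  The third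
    one makes the weighted recurrence for the ratios a contraction of factor
    [3 / 4]; the last one says that [P x / x ^ 4] has defect [O(x ^ -5)]. *)
Definition ratio_model (R : realFieldType) (alpha beta gamma P : R -> R)
    (low C : R) (n0 : nat) : Prop :=
  forall x, n0%:R <= x ->
    [/\ 0 < gamma x, 0 < P x,
        `|4 * (beta x * (x + 1) ^+ 4)| <= 3 * low * (gamma x * P x) &
        `|((x + 1) ^+ 4 * (alpha x * P x + beta x * x ^+ 4)
          - gamma x * P x * P (x + 1)) * x| <= C * (gamma x * P x)].

(** If [r] solves [r' = A + B / r] and [e] does so up to a defect, then
    [r' - e' = B * (e - r) / (r * e) - defect]; this is multiplied by
    [(x + 1) ^ 4]. *)
Lemma ratio_expansion_of_recurrence (R : archiRealFieldType) (a : nat -> R)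
    (alpha beta gamma P : R -> R) (low C : R) (n0 : nat) :
  ratio_model alpha beta gamma P low C n0 -> 0 < low ->
  (forall n, (n0 <= n)%N -> 0 < a n) ->
  (forall n, (n0 <= n)%N -> low * a n <= a n.+1) ->
  (forall n, gamma n%:R * a n.+2 = alpha n%:R * a n.+1 + beta n%:R * a n) ->
  vanishes (fun n => n%:R ^+ 4 * (a n.+1 / a n) - P n%:R).
Proof.
move=> hx low0 a0 a_low rec.
suff h : vanishes (fun n => `|n%:R ^+ 4 * (a n.+1 / a n) - P n%:R|).
  by move=> eps /h[N hN]; exists N => n /hN; rewrite normr_id.
apply: (@contraction_vanishes _ _ (fun n => C / n%:R) (3%:R / 4%:R) n0.+1).
- by lra.
- by [].
- exact: vanishes_divn.
move=> n le_n.
have an0 := a0 n (ltnW le_n); have low_n := a_low n (ltnW le_n).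
have an1 := a0 n.+1 (leqW (ltnW le_n)); have {}rec := rec n.
have x_n0 : n0%:R <= n%:R :> R by rewrite ler_nat ltnW.
have x0 : 0 < n%:R :> R by rewrite ltr0n; lia.
have {hx} := hx n%:R x_n0; rewrite -[n.+1%:R]natr1.
move: (n%:R) x0 rec => x x0 rec [g0 P0 hbeta hdefect].
set e := P x; rewrite -/e in P0 hbeta hdefect.
have ge0 : 0 < gamma x * e by rewrite mulr_gt0.
set r := a n.+1 / a n.
have r0 : low <= r by rewrite ler_pdivlMr.
have rpos : 0 < r by apply: lt_le_trans r0.
have nz : [/\ a n != 0, a n.+1 != 0, gamma x != 0 & e != 0].
  by rewrite !gt_eqF.
case: nz => nz0 nz1 nzg nze.
have -> : (x + 1) ^+ 4 * (a n.+2 / a n.+1) - P (x + 1) =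
    beta x * (x + 1) ^+ 4 / (r * (gamma x * e)) * (e - x ^+ 4 * r) +
    ((x + 1) ^+ 4 * (alpha x * e + beta x * x ^+ 4)
      - gamma x * e * P (x + 1)) / (gamma x * e).
  have -> : a n.+2 = (alpha x * a n.+1 + beta x * a n) / gamma x.
    by rewrite -rec mulrC mulKf.
  by rewrite /r; field; rewrite nz0 nz1 nzg nze.
apply: (le_trans (ler_normD _ _)); apply: lerD.
  have den0 : 0 < r * (gamma x * e) by apply: mulr_gt0.
  rewrite normrM distrC ler_wpM2r // normrM normfV (gtr0_norm den0).
  rewrite normrM gtr0_norm // in hbeta; rewrite ler_pdivrMr //.
  have : low * (gamma x * e) <= r * (gamma x * e) by rewrite ler_wpM2r // ltW.
  lra.
rewrite normrM (gtr0_norm x0) in hdefect.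
rewrite normrM normfV (gtr0_norm ge0) ler_pdivrMr // [leRHS]mulrAC ler_pdivlMr //.
Qed.

Lemma two_log_convex_of_recurrence (R : archiRealFieldType) (a : nat -> R)
    (alpha beta gamma : R -> R) (c0 c1 c2 c3 c4 low C : R) (n0 : nat) :
  ratio_model alpha beta gamma (quartic c0 c1 c2 c3 c4) low C n0 ->
  0 < low -> c1 < 0 ->
  (forall n, (n0 <= n)%N -> 0 < a n) ->
  (forall n, (n0 <= n)%N -> low * a n <= a n.+1) ->
  (forall n, gamma n%:R * a n.+2 = alpha n%:R * a n.+1 + beta n%:R * a n) ->
  eventually_strictly_two_log_convex a.
Proof.
move=> hx low0 c10 a0 a_low rec; apply: (two_log_convex_of_ratio_expansion a0 c10).
exact: ratio_expansion_of_recurrence hx low0 a0 a_low rec.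
Qed.

(** For nonnegative [beta] the recurrence itself bounds the ratios below by
    [alpha / gamma]. *)
Lemma two_log_convex_of_nonneg_recurrence (R : archiRealFieldType)
    (a : nat -> R) (alpha beta gamma : R -> R) (c0 c1 c2 c3 c4 low C : R)
    (n0 : nat) :
  ratio_model alpha beta gamma (quartic c0 c1 c2 c3 c4) low C n0 ->
  0 < low -> c1 < 0 ->
  (forall x, n0%:R <= x -> 0 <= beta x /\ low * gamma x <= alpha x) ->
  (forall n, (n0 <= n)%N -> 0 < a n) ->
  (forall n, gamma n%:R * a n.+2 = alpha n%:R * a n.+1 + beta n%:R * a n) ->
  eventually_strictly_two_log_convex a.
Proof.
move=> hx low0 c10 coef a0 rec.
apply: (@two_log_convex_of_recurrence _ a alpha beta gamma
  c0 c1 c2 c3 c4 low C n0.+1) => //.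
- by move=> x le_x; apply: hx; apply: le_trans le_x; rewrite ler_nat.
- by move=> n /ltnW /a0.
case=> // n le_n; have x_n : n0%:R <= n%:R :> R by rewrite ler_nat.
have [b0 le_alpha] := coef _ x_n; have [g0 _ _ _] := hx _ x_n.
rewrite -(ler_pM2l g0) rec mulrCA mulrA ler_wpDr ?mulr_ge0 ?(ltW (a0 _ _)) //.
by rewrite ler_wpM2r // ltW // a0 // leqW.
Qed.

(** * Quartic models of the ratios *)

(** Applied to a polynomial inequality in [y >= 0] in which, after collecting
    terms, every monomial has the right sign; the monomials are the atoms of a
    linear problem. *)
Ltac polynomial_sign y0 :=
  do [have := exprn_ge0 2 y0; have := exprn_ge0 3 y0; have := exprn_ge0 4 y0;
  have := exprn_ge0 5 y0; have := exprn_ge0 6 y0; have := exprn_ge0 7 y0;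
  have := exprn_ge0 8 y0; have := exprn_ge0 9 y0; have := exprn_ge0 10 y0;
  have := exprn_ge0 11 y0; have := exprn_ge0 12 y0; lra].

(** In each of the following lemmas the coefficients of the quartic are obtained
    by solving
    [P (x + 1) / (x + 1) ^ 4 = alpha / gamma + beta * x ^ 4 / (gamma * P x)]
    order by order in [1 / x].  The leading one is the growth rate [c0] of the
    sequence, a root of the characteristic equation, and [- c1 / c0] is the
    exponent of [1 / n] in its asymptotic form.  The bounds [100] and [1000] are
    generous.  Some coefficients are written as sums to keep their (unary)
    numerals small. *)
Lemma motzkin_ratio_model (R : realFieldType) :
  ratio_model (fun x : R => 2 * x + 5) (fun x => 3 * (x + 1))
    (fun x => x + 4)
    (quartic 3 (- (9 / 2)) (207 / 16) (- (153 / 4))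
      (114 + 327 / 1024)) (3 / 2) 1000 100.
Proof.
move=> x; rewrite -subr_ge0 => y0; have -> : x = (x - 100) + 100 by ring.
move: (x - 100) y0 => y y0; rewrite /quartic.
split; rewrite ?ler_norml; do ?[apply/andP; split]; polynomial_sign y0.
Qed.

Lemma motzkin_coefficients (R : realFieldType) (x : R) :
  100%:R <= x -> 0 <= 3 * (x + 1) /\ (3 / 2) * (x + 4) <= 2 * x + 5.
Proof.
rewrite -subr_ge0 => y0; have -> : x = (x - 100) + 100 by ring.
by move: (x - 100) y0 => y y0; split; polynomial_sign y0.
Qed.

Lemma fine_ratio_model (R : realFieldType) :
  ratio_model (fun x : R => 7 * x + 9) (fun x => 4 * x + 6)
    (fun x => 2 * x + 6)
    (quartic 4 (- 6) (38 / 3) (- (682 / 27)) (50 + 16 / 81)) 1 1000 100.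
Proof.
move=> x; rewrite -subr_ge0 => y0; have -> : x = (x - 100) + 100 by ring.
move: (x - 100) y0 => y y0; rewrite /quartic.
split; rewrite ?ler_norml; do ?[apply/andP; split]; polynomial_sign y0.
Qed.

Lemma fine_coefficients (R : realFieldType) (x : R) :
  100%:R <= x -> 0 <= 4 * x + 6 /\ 1 * (2 * x + 6) <= 7 * x + 9.
Proof.
rewrite -subr_ge0 => y0; have -> : x = (x - 100) + 100 by ring.
by move: (x - 100) y0 => y y0; split; polynomial_sign y0.
Qed.

Lemma franel3_ratio_model (R : realFieldType) :
  ratio_model (fun x : R => 7 * x ^+ 2 + 21 * x + 16) (fun x => 8 * (x + 1) ^+ 2)
    (fun x => (x + 2) ^+ 2)
    (quartic 8 (- 8) (32 / 3) (- (352 / 27)) (416 / 27)) 4 1000 100.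
Proof.
move=> x; rewrite -subr_ge0 => y0; have -> : x = (x - 100) + 100 by ring.
move: (x - 100) y0 => y y0; rewrite /quartic.
split; rewrite ?ler_norml; do ?[apply/andP; split]; polynomial_sign y0.
Qed.

Lemma franel3_coefficients (R : realFieldType) (x : R) :
  100%:R <= x ->
  0 <= 8 * (x + 1) ^+ 2 /\ 4 * (x + 2) ^+ 2 <= 7 * x ^+ 2 + 21 * x + 16.
Proof.
rewrite -subr_ge0 => y0; have -> : x = (x - 100) + 100 by ring.
by move: (x - 100) y0 => y y0; split; polynomial_sign y0.
Qed.

Lemma franel4_ratio_model (R : realFieldType) :
  ratio_model (fun x : R => (4 * x + 6) * (3 * x ^+ 2 + 9 * x + 7))
    (fun x => 4 * (x + 1) * (4 * x + 3) * (4 * x + 5))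
    (fun x => (x + 2) ^+ 3)
    (quartic 16 (- 24) 39 (- (113 / 2)) (153 / 2)) 8 1000 100.
Proof.
move=> x; rewrite -subr_ge0 => y0; have -> : x = (x - 100) + 100 by ring.
move: (x - 100) y0 => y y0; rewrite /quartic.
split; rewrite ?ler_norml; do ?[apply/andP; split]; polynomial_sign y0.
Qed.

Lemma franel4_coefficients (R : realFieldType) (x : R) :
  100%:R <= x ->
  0 <= 4 * (x + 1) * (4 * x + 3) * (4 * x + 5) /\
  8 * (x + 2) ^+ 3 <= (4 * x + 6) * (3 * x ^+ 2 + 9 * x + 7).
Proof.
rewrite -subr_ge0 => y0; have -> : x = (x - 100) + 100 by ring.
by move: (x - 100) y0 => y y0; split; polynomial_sign y0.
Qed.

(** The model splits as [P = p + s * q] with rational [p] and [q], and modulo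
    [s ^ 2 = 2] so does its defect, as [A + s * B].  Each part satisfies the
    bound on its own, which leaves inequalities with rational coefficients. *)
Lemma schroeder_ratio_model (R : realFieldType) (s : R) :
  0 <= s -> s ^+ 2 = 2 ->
  ratio_model (fun x : R => 6 * x + 9) (fun x => - x) (fun x => x + 3)
    (quartic (3 + 2 * s) (- (9 / 2) - 3 * s) (9 + 195 / 32 * s)
      (- (1143 / 64) - 783 / 64 * s) (2277 / 64 + (24 + 2463 / 4096) * s))
    2 1000 100.
Proof.
move=> s0 s2 x x100; set P := quartic _ _ _ _ _.
pose p := quartic (3 : R) (- (9 / 2)) 9 (- (1143 / 64)) (2277 / 64).
pose q := quartic (2 : R) (- 3) (195 / 32) (- (783 / 64)) (24 + 2463 / 4096).
have PE y : P y = p y + s * q y by rewrite /P /p /q /quartic; ring.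
pose A := (x + 1) ^+ 4 * ((6 * x + 9) * p x - x ^+ 5)
  - (x + 3) * (p x * p (x + 1) + 2 * (q x * q (x + 1))).
pose B := (x + 1) ^+ 4 * ((6 * x + 9) * q x)
  - (x + 3) * (p x * q (x + 1) + q x * p (x + 1)).
have defectE : (x + 1) ^+ 4 * ((6 * x + 9) * P x + - x * x ^+ 4)
    - (x + 3) * P x * P (x + 1) = A + s * B.
  by rewrite /A /B -s2 !PE; ring.
have [p0 q0 hbeta hA hB] : [/\ 0 < p x, 0 < q x,
    4 * (x * (x + 1) ^+ 4) <= 6 * ((x + 3) * p x),
    `|A * x| <= 1000 * ((x + 3) * p x) & `|B * x| <= 1000 * ((x + 3) * q x)].
  rewrite /A /B /p /q /quartic; clear p q A B P PE defectE.
  have y0 : 0 <= x - 100 by rewrite subr_ge0.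
  have -> : x = (x - 100) + 100 by ring.
  move: (x - 100) y0 => y y0.
  split; rewrite ?ler_norml; do ?[apply/andP; split]; polynomial_sign y0.
rewrite defectE !PE; clear defectE PE P.
move: (p x) (q x) p0 q0 hbeta hA hB => px qx p0 q0 hbeta hA hB.
clearbody A B; clear p q.
have sq0 : 0 <= s * qx by rewrite mulr_ge0 // ltW.
have x1 : 0 <= x * (x + 1) ^+ 4 by rewrite mulr_ge0 ?exprn_ge0 //; lra.
have xsq0 : 0 <= (x + 3) * (s * qx) by rewrite mulr_ge0 //; lra.
split; first lra.
- by rewrite ltr_wpDr.
- by rewrite mulNr mulrN normrN ger0_norm; lra.
rewrite mulrDl -[s * B * x]mulrA; apply: (le_trans (ler_normD _ _)).
rewrite [`|s * _|]normrM (ger0_norm s0); have := ler_wpM2l s0 hB; lra.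
Qed.

(** * The five sequences *)

Lemma sum_ord_gt0 (F : nat -> rat) (n : nat) :
  0 < F 0%N -> (forall k, 0 <= F k) -> 0 < \sum_(k < n.+1) F k.
Proof.
by move=> F0 Fge0; rewrite big_ord_recl /= ltr_pwDl // sumr_ge0.
Qed.

Lemma catalan_ge0 (k : nat) : 0 <= catalan k.
Proof. by rewrite divr_ge0. Qed.

Lemma motzkin_gt0 (n : nat) : 0 < motzkin n.
Proof.
apply: (sum_ord_gt0 (F := fun k => 'C(n, 2 * k)%:R * catalan k)) => [|k].
  by rewrite bin0 mul1r divr_gt0 // bin0.
by rewrite mulr_ge0 ?catalan_ge0.
Qed.

Lemma schroeder_gt0 (n : nat) : 0 < schroeder n.
Proof.
apply: (sum_ord_gt0 (F := fun k => 'C(n + k, 2 * k)%:R * catalan k)) => [|k].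
  by rewrite bin0 mul1r divr_gt0 // bin0.
by rewrite mulr_ge0 ?catalan_ge0.
Qed.

Lemma franel_gt0 (r n : nat) : 0 < franel r n.
Proof.
apply: (sum_ord_gt0 (F := fun k => 'C(n, k)%:R ^+ r)) => [|k].
  by rewrite bin0 expr1n.
by rewrite exprn_ge0.
Qed.

Lemma fine_step_gt0 (R : realFieldType) (x f0 f1 f2 : R) :
  (2 * x + 6) * f2 = (7 * x + 9) * f1 + (4 * x + 6) * f0 ->
  0 <= x -> 0 <= f0 -> 0 <= f1 -> 0 < f0 + f1 -> 0 < f2.
Proof.
move=> rec x0 f00 f10 f01.
rewrite -(pmulr_rgt0 _ (_ : 0 < 2 * x + 6)) ?rec; last lra.
by have := mulr_ge0 x0 f00; have := mulr_ge0 x0 f10; lra.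
Qed.

(** [fine 1] is zero, so positivity starts at index 2. *)
Lemma fine_gt0 (n : nat) : 0 < fine n.+2.
Proof.
suff: 0 < fine n.+2 /\ 0 <= fine n.+1 by case.
elim: n => [|n [IH2 IH1]].
  have f0 : fine 0 = 1 by [].
  have f1 : fine 1 = 0.
    by rewrite /= /catalan muln1 [X in X / _ - 1](_ : _ = 2%:R) // divff //
      subrr mul0r.
  by rewrite (fine_step_gt0 (fine_recurrence 0)) ?f0 ?f1 ?addr0.
by rewrite (fine_step_gt0 (fine_recurrence n.+1)) ?ltr_wpDl // ?(ltW IH2).
Qed.

Lemma schroeder_step_double (R : realFieldType) (x s0 s1 s2 : R) :
  (x + 3) * s2 = (6 * x + 9) * s1 - x * s0 ->
  0 <= x -> 0 <= s1 -> 2 * s0 <= s1 -> 2 * s1 <= s2.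
Proof.
move=> rec x0 s10 le01; rewrite -(ler_pM2l (_ : 0 < x + 3)) ?rec; last lra.
by have := mulr_ge0 x0 s10; have := ler_wpM2l x0 le01; lra.
Qed.

(** The coefficient [- n] is negative here, so the lower bound on the ratios
    needs its own induction. *)
Lemma schroeder_double (n : nat) : 2 * schroeder n <= schroeder n.+1.
Proof.
elim: n => [|n IHn].
  rewrite /schroeder !big_ord_recr !big_ord0 /= /catalan.
  rewrite !(bin0, binn, muln0, muln1, addn0, addn1).
  by rewrite [X in X / 2](_ : _ = 2%:R) // !mul1r !divr1 divff // add0r mulr1.
apply: (schroeder_step_double (schroeder_recurrence n)) => //.
exact/ltW/schroeder_gt0.
Qed.

Lemma motzkin_two_log_convex : eventually_strictly_two_log_convex motzkin.
Proof.
apply: (two_log_convex_of_nonneg_recurrence (@motzkin_ratio_model rat)).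
- by rewrite divr_gt0.
- by rewrite oppr_lt0 divr_gt0.
- exact: motzkin_coefficients.
- by move=> n _; apply: motzkin_gt0.
- exact: motzkin_recurrence.
Qed.

Lemma fine_two_log_convex : eventually_strictly_two_log_convex fine.
Proof.
apply: (two_log_convex_of_nonneg_recurrence (@fine_ratio_model rat)).
- by [].
- by rewrite oppr_lt0 ltr0n.
- exact: fine_coefficients.
- by case=> [|[|n]] // _; apply: fine_gt0.
- exact: fine_recurrence.
Qed.

Lemma franel3_two_log_convex : eventually_strictly_two_log_convex (franel 3).
Proof.
apply: (two_log_convex_of_nonneg_recurrence (@franel3_ratio_model rat)).
- by rewrite ltr0n.
- by rewrite oppr_lt0 ltr0n.
- exact: franel3_coefficients.
- by move=> n _; apply: franel_gt0.
- exact: franel3_recurrence.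
Qed.

Lemma franel4_two_log_convex : eventually_strictly_two_log_convex (franel 4).
Proof.
apply: (two_log_convex_of_nonneg_recurrence (@franel4_ratio_model rat)).
- by rewrite ltr0n.
- by rewrite oppr_lt0 ltr0n.
- exact: franel4_coefficients.
- by move=> n _; apply: franel_gt0.
- exact: franel4_recurrence.
Qed.

Lemma schroeder_two_log_convex : eventually_strictly_two_log_convex schroeder.
Proof.
pose a n : realalg := ratr (schroeder n).
suff [N N0 hN] : eventually_strictly_two_log_convex a.
  exists N => // n /hN; rewrite /a -!rmorphXn -!rmorphM -!rmorphB /= -!rmorphXn.
  by rewrite -!rmorphM /= ler_rat ltr_rat.
pose s : realalg := Num.sqrt 2.
have s0 : 0 <= s by apply: sqrtr_ge0.
have s2 : s ^+ 2 = 2 by rewrite sqr_sqrtr.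
apply: (two_log_convex_of_recurrence (schroeder_ratio_model s0 s2)).
- by rewrite ltr0n.
- lra.
- by move=> n _; rewrite ltr0q schroeder_gt0.
- by move=> n _; rewrite -(ratr_nat _ 2) -rmorphM ler_rat schroeder_double.
- move=> n; rewrite /a mulNr.
  transitivity (ratr ((n%:R + 3) * schroeder n.+2) : realalg).
    by rewrite rmorphM /= [ratr (_ + 3)]rmorphD /= !ratr_nat.
  rewrite schroeder_recurrence rmorphB; congr (_ - _); last first.
    by rewrite rmorphM /= ratr_nat.
  by rewrite rmorphM /= [ratr (_ + 9)]rmorphD /= [ratr (6 * _)]rmorphM /= !ratr_nat.
Qed.

Theorem mainTheorem5 (a : nat -> rat)
  (ha : a = motzkin \/ a = fine \/ a = franel 3 \/ a = franel 4 \/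
        a = schroeder) :
  exists2 N : nat, (0 < N)%N &
    forall n : nat, (N <= n)%N ->
      a n ^+ 2 <= a n.-1 * a n.+1 /\
      (a n * a n.+2 - a n.+1 ^+ 2) ^+ 2
        < (a n.-1 * a n.+1 - a n ^+ 2) * (a n.+1 * a n.+3 - a n.+2 ^+ 2).
Proof.
case: ha => [->|[->|[->|[->|->]]]].
- exact: motzkin_two_log_convex.
- exact: fine_two_log_convex.
- exact: franel3_two_log_convex.
- exact: franel4_two_log_convex.
- exact: schroeder_two_log_convex.
Qed.
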